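(* Let $W$ be a nondeterministic recursive probabilistic program (given by its control-flow graph) with a sampling function $\Upsilon$. Then the function $\overline T:\mathcal E\to[0,\infty]$ (supremum over schedulers of the expected termination time) is a ranking measure function for $W$ with corresponding constant $\epsilon=1$.
   Context: **Programs.** For a finite set $V$ of variables, $\mathrm{Val}_V$ is the set of functions (valuations) $V\to\mathbb Z$. A nondeterministic recursive probabilistic program $W$ is represented by its control-flow graph: a finite set $F$ of function names, a finite set $V_r$ of sampling variables and, for each $f\in F$: a finite set $V^f$ of program variables (write $\mathrm{Val}_f:=\mathrm{Val}_{V^f}$); a finite set $L^f$ of labels partitioned into branching labels $L_b^f$, assignment labels $L_a^f$, call labels $L_c^f$ and nondeterministic labels $L_d^f$; an initial label $\ell_{in}^f\in L^f$ and a terminal label $\ell_{out}^f\in L^f$ with $\ell_{in}^f\ne\ell_{out}^f$; and a set $\to_f$ of triples (source label, decoration, target label). For each $\ell\in L^f\setminus\{\ell_{out}^f\}$ the triples with source $\ell$ are: - if $\ell\in L_a^f$: exactly one triple $(\ell,u,\ell')$ with update function $u:\mathrm{Val}_f\times\mathrm{Val}_{V_r}\to\mathrm{Val}_f$; - if $\ell\in L_c^f$: exactly one triple $(\ell,(g,v),\ell')$ with $g\in F$ and value-passing function $v:\mathrm{Val}_f\to\mathrm{Val}_g$; - if $\ell\in L_b^f$: exactly two triples $(\ell,\phi,\ell_1),(\ell,\neg\phi,\ell_2)$ with $\phi$ a propositional arithmetic predicate over $V^f$ (Boolean combination of comparisons of integer-valued arithmetic expressions); - if $\ell\in L_d^f$: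 exactly two triples $(\ell,\star,\ell_1),(\ell,\star,\ell_2)$ (the then-branch and the else-branch, respectively). **Sampling.** A sampling function $\Upsilon$ assigns to each $r\in V_r$ a discrete probability distribution on $\mathbb Z$; $\overline\Upsilon(\mu):=\prod_{r\in V_r}\Upsilon(r)(\mu(r))$ for $\mu\in\mathrm{Val}_{V_r}$, and $\mathrm{Val}^r:=\{\mu:\overline\Upsilon(\mu)>0\}$. **Semantics.** A stack element is a triple $(f,\ell,\nu)$ with $f\in F$, $\ell\in L^f$, $\nu\in\mathrm{Val}_f$; it is terminal if $\ell=\ell_{out}^f$. $\mathcal E$ is the set of stack elements. A configuration is a finite word (possibly the empty word $\varepsilon$) of non-terminal stack elements, the first letter being the top of the stack. For a stack element $\mathfrak d$ let $[\mathfrak d]$ be the one-letter word $\mathfrak d$ if $\mathfrak d$ is non-terminal and $\varepsilon$ otherwise. States are pairs $(w,\mu)$ of a configuration and $\mu\in\mathrm{Val}_{V_r}$. In one step from $((f,\ell,\nu)\cdot w,\mu)$, $\mu'$ is drawn with probability $\overline\Upsilon(\mu')$ and the next state is $(w',\mu')$ where - assignment: $w'=[(f,\ell',u(\nu,\mu'))]\cdot w$; - call: $w'=(g,\ell_{in}^g,v(\nu))\cdot[(f,\ell',\nu)]\cdot w$; - branching: $w'=[(f,\ell_1,\nu)]\cdot w$ if $\nu\models\phi$, and $w'=[(f,\ell_2,\nu)]\cdot w$ otherwise; - nondeterministic: $w'=[(f,\ell_1,\nu)]\cdot w$ under action $\mathbf{th}$ and $w'=[(f,\ell_2,\nu)]\cdot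 w$ under action $\mathbf{el}$. From $(\varepsilon,\mu)$ the next state is $(\varepsilon,\mu')$ with probability $\overline\Upsilon(\mu')$. In non-nondeterministic states there is effectively a single action $\tau$; when the top label is nondeterministic the enabled actions are $\mathbf{th},\mathbf{el}$. A history is a finite nonempty sequence of states in which each consecutive pair has positive transition probability under some action. A scheduler $\sigma$ maps every history to a probability distribution over the actions enabled at its last state. For a scheduler $\sigma$ and a non-terminal stack element $\mathfrak c$, $\mathbb P^\sigma_{\mathfrak c}$ (expectation $\mathbb E^\sigma_{\mathfrak c}$) is the induced probability measure on infinite sequences of states starting in $(\mathfrak c,\mathbf 0)$, where $\mathbf 0$ is the zero valuation. **Termination time.** $T(\{(w_n,\mu_n)\}_{n\ge0}):=\min\{n\ge 0: w_n=\varepsilon\}$ ($\min\emptyset=\infty$). $\overline T:\mathcal E\to[0,\infty]$ is $\overline T(\mathfrak c):=\sup_\sigma\mathbb E^\sigma_{\mathfrak c}(T)$ if $\mathfrak c$ is non-terminal (sup over all schedulers), and $\overline T(\mathfrak c):=0$ if terminal. **Ranking measure functions.** A ranking measure function for $W$ with corresponding constant $\epsilon\in(0,\infty)$ is a function $h:\mathcal E\to[0,\infty]$ such that for all stack elements $(f,\ell,\nu)$: - (C1) if $\ell=\ell_{out}^f$ then $h(f,\ell,\nu)=0$; - (C2) if $\ell\in L_a^f\setminus\{\ell_{out}^f\}$ and $(\ell,u,\ell')$ is the only triple in $\to_f$ with source $\ell$: $\epsilon+\sum_{\mu\in\mathrm{Val}^r}\overline\Upsilon(\mu)\,h(f,\ell',u(\nu,\mu))\le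 h(f,\ell,\nu)$; - (C3) if $\ell\in L_c^f\setminus\{\ell_{out}^f\}$ and $(\ell,(g,v),\ell')$ is the only triple in $\to_f$ with source $\ell$: $\epsilon+h(g,\ell_{in}^g,v(\nu))+h(f,\ell',\nu)\le h(f,\ell,\nu)$; - (C4) if $\ell\in L_b^f\setminus\{\ell_{out}^f\}$ and $(\ell,\phi,\ell_1),(\ell,\neg\phi,\ell_2)$ are the two triples in $\to_f$ with source $\ell$: $\mathbf 1_{\nu\models\phi}h(f,\ell_1,\nu)+\mathbf 1_{\nu\models\neg\phi}h(f,\ell_2,\nu)+\epsilon\le h(f,\ell,\nu)$; - (C5) if $\ell\in L_d^f\setminus\{\ell_{out}^f\}$ and $(\ell,\star,\ell_1),(\ell,\star,\ell_2)$ are the two triples in $\to_f$ with source $\ell$: $\max\{h(f,\ell_1,\nu),h(f,\ell_2,\nu)\}+\epsilon\le h(f,\ell,\nu)$. Conventions: $d\cdot\infty=\infty$ for $d\in(0,\infty]$, $0\cdot\infty=0$. *)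

(* Defs.v *)
From HB Require Import structures.
From mathcomp Require Import all_boot all_order all_algebra.
From mathcomp Require Import all_classical all_reals all_analysis.

Set Implicit Arguments.
Unset Strict Implicit.
Unset Printing Implicit Defensive.

Import Order.TTheory GRing.Theory Num.Theory.

Local Open Scope classical_set_scope.
Local Open Scope ring_scope.

Notation valuation V := {ffun V -> int} (only parsing).

(* The binary operations on int are left arbitrary, so that any repertoire of
   arithmetic operators (+, -, *, floored division, ...) is covered. *)
Inductive aexpr (V : Type) : Type :=
| AConst of int
| AVar of V
| AOp of (int -> int -> int) & aexpr V & aexpr V.

Inductive predicate (V : Type) : Type :=
| PLe of aexpr V & aexpr V
| PLt of aexpr V & aexpr V
| PEq of aexpr V & aexpr V
| PNot of predicate V
| PAnd of predicate V & predicate V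
| POr of predicate V & predicate V.

Fixpoint aeval (V : finType) (nu : valuation V) (e : aexpr V) : int :=
  match e with
  | AConst z => z
  | AVar x => nu x
  | AOp op e1 e2 => op (aeval nu e1) (aeval nu e2)
  end.

Fixpoint sat (V : finType) (nu : valuation V) (phi : predicate V) : bool :=
  match phi with
  | PLe e1 e2 => aeval nu e1 <= aeval nu e2
  | PLt e1 e2 => aeval nu e1 < aeval nu e2
  | PEq e1 e2 => aeval nu e1 == aeval nu e2
  | PNot p => ~~ sat nu p
  | PAnd p q => sat nu p && sat nu q
  | POr p q => sat nu p || sat nu q
  end.

(* The outgoing transitions of a label of the function f.  The constructor
   records which block of the partition (assignment, call, branching,
   nondeterministic) the label belongs to; the arguments record the decoration
   and the target(s): the single triple for Assign and Call, the triples of phi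
   and of its negation (in this order) for Branch, the then- and the
   else-triple (in this order) for Ndet. *)
Inductive instruction (F Vr : finType) (V L : F -> finType) (f : F) : Type :=
| Assign of (valuation (V f) -> valuation Vr -> valuation (V f))
    & L f
| Call (g : F) of (valuation (V f) -> valuation (V g)) & L f
| Branch of predicate (V f) & L f & L f
| Ndet of L f & L f.
Arguments Assign {F Vr V L f}.
Arguments Call {F Vr V L f}.
Arguments Branch {F Vr V L f}.
Arguments Ndet {F Vr V L f}.

(* The value of instr at a terminal label is irrelevant: it is used neither by
   the semantics nor by ranking measure functions. *)
Record program := Program {
  fname : finType;
  svar : finType;
  pvar : fname -> finType;
  label : fname -> finType;
  l_in : forall f, label f;
  l_out : forall f, label f;
  l_in_neq_out : forall f, l_in f != l_out f;
  instr : forall f, label f -> instruction svar pvar label f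
}.

Record distrZ (R : realType) := DistrZ {
  pmf :> int -> R;
  pmf_ge0 : forall z, 0 <= pmf z;
  pmf_sum1 : \esum_(z in [set: int]) (pmf z)%:E = 1%E
}.

Definition sampling (R : realType) (W : program) := svar W -> distrZ R.

Definition joint (R : realType) (W : program) (U : sampling R W)
    (mu : valuation (svar W)) : R :=
  \prod_(r : svar W) U r (mu r).

Section Semantics.
Variable W : program.

Definition elem : Type :=
  {f : fname W & (label f * valuation (pvar f))%type}.

HB.instance Definition _ := Countable.on elem.

Definition mkelem (f : fname W) (l : label f) (nu : valuation (pvar f)) :
  elem := Tagged (fun f => (label f * valuation (pvar f))%type) (l, nu).

Definition terminal (d : elem) : bool := (tagged d).1 == l_out (tag d).

Definition config : Type := seq {d : elem | ~~ terminal d}.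

HB.instance Definition _ := Countable.on config.

(* push d w is the concatenation [d] . w *)
Definition push (d : elem) (w : config) : config :=
  if insub d is Some d' then d' :: w else w.

Definition state : Type := (config * valuation (svar W))%type.

HB.instance Definition _ := Countable.on state.
HB.instance Definition _ := isPointed.Build state ([::], [ffun=> 0]).

Inductive action := Tau | Th | El.

Definition action_code (a : action) : option bool :=
  match a with Tau => None | Th => Some true | El => Some false end.
Definition action_decode (c : option bool) : action :=
  match c with None => Tau | Some true => Th | Some false => El end.
Lemma action_codeK : cancel action_code action_decode.
Proof. by case. Qed.
HB.instance Definition _ := Finite.copy action (can_type action_codeK).

Definition is_ndet (f : fname W) (l : label f) : bool :=
  if instr l is Ndet _ _ then true else false.

Definition enabled (s : state) (a : action) : bool :=
  let ndet := if s.1 is d :: _ then is_ndet (tagged (\val d)).1 else false in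
  if a is Tau then ~~ ndet else ndet.

(* In the Ndet case only the values at Th and El are meaningful (see trans). *)
Definition next_config (w : config) (a : action) (mu' : valuation (svar W)) :
    config :=
  if w is d :: w' then
    let: existT f (l, nu) := \val d in
    match instr l with
    | Assign u l' => push (mkelem l' (u nu mu')) w'
    | Call g v l' => push (mkelem (l_in g) (v nu)) (push (mkelem l' nu) w')
    | Branch phi l1 l2 => push (mkelem (if sat nu phi then l1 else l2) nu) w'
    | Ndet l1 l2 => push (mkelem (if a is Th then l1 else l2) nu) w'
    end
  else [::].

Definition init (c : elem) : state := (push c [::], [ffun=> 0]).

Variables (R : realType) (U : sampling R W).

Definition trans (s : state) (a : action) (s' : state) : R :=
  if enabled s a && (s'.1 == next_config s.1 a s'.2) then joint U s'.2 else 0.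

(* Histories are given in the exploded form of path.v: (s, t) stands for the
   nonempty sequence s :: t, whose last element is last s t. *)
Definition history (s : state) (t : seq state) : bool :=
  path (fun s1 s2 => [exists a, 0 < trans s1 a s2]) s t.

(* Values outside histories are unconstrained, and play no role. *)
Record scheduler := Scheduler {
  sched :> state -> seq state -> action -> R;
  sched_ge0 : forall s t a, history s t -> 0 <= sched s t a;
  sched_enabled : forall s t a,
    history s t -> ~~ enabled (last s t) a -> sched s t a = 0;
  sched_sum1 : forall s t, history s t -> \sum_(a : action) sched s t a = 1
}.

Definition cylinder (s : state) (t : seq state) : set (nat -> state) :=
  [set w | forall i, (i <= size t)%N -> w i = nth s (s :: t) i].

Definition cylinders : set (set (nat -> state)) :=
  [set cylinder st.1 st.2 | st in [set: state * seq state]].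

(* Infinite sequences of states with the sigma-algebra generated by the
   cylinders (the product sigma-algebra, as there are countably many states). *)
Definition runs := g_sigma_algebraType cylinders.

Definition step (sigma : scheduler) (s : state) (t : seq state) (s' : state) :
    R :=
  \sum_(a : action) sigma s t a * trans (last s t) a s'.

(* P is the measure induced by sigma from ((c), 0).  The values on cylinders
   determine P, as the cylinders (with the empty set) form a pi-system
   generating the sigma-algebra of runs; P exists by the Ionescu-Tulcea
   theorem. *)
Definition induced_measure (sigma : scheduler) (c : elem)
    (P : probability runs R) : Prop :=
  (forall s, P (cylinder s [::]) = ((s == init c)%:R)%:E) /\
  (forall s t s', history s t ->
     P (cylinder s (rcons t s')) =
     (P (cylinder s t) * (step sigma s t s')%:E)%E).

Definition termination_time (w : runs) : \bar R :=
  ereal_inf [set n%:R%:E | n in [set n : nat | (w n).1 = [::]]].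

Definition Tbar (c : elem) : \bar R :=
  if terminal c then 0%E else
  ereal_sup [set x | exists (sigma : scheduler) (P : probability runs R),
    induced_measure sigma c P /\ x = (\int[P]_w termination_time w)%E].

Local Open Scope ereal_scope.

Definition ranking_measure_function (eps : R) (h : elem -> \bar R) : Prop :=
  [/\ (0 < eps)%R,
      forall d, 0 <= h d,
      forall f (nu : valuation (pvar f)), h (mkelem (l_out f) nu) = 0 &
      forall f (l : label f) (nu : valuation (pvar f)), l != l_out f ->
        match instr l with
        | Assign u l' =>
            eps%:E + \esum_(mu in [set mu | (0 < joint U mu)%R])
                       ((joint U mu)%:E * h (mkelem l' (u nu mu)))
            <= h (mkelem l nu)
        | Call g v l' =>
            eps%:E + h (mkelem (l_in g) (v nu)) + h (mkelem l' nu)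
            <= h (mkelem l nu)
        | Branch phi l1 l2 =>
            (sat nu phi)%:R%:E * h (mkelem l1 nu)
            + (sat nu (PNot phi))%:R%:E * h (mkelem l2 nu) + eps%:E
            <= h (mkelem l nu)
        | Ndet l1 l2 =>
            maxe (h (mkelem l1 nu)) (h (mkelem l2 nu)) + eps%:E
            <= h (mkelem l nu)
        end].

End Semantics.

(* Main.v *)
(** The values [value n w] of the optimal expectation of [min (T, n)] from the
    configuration [w] satisfy a Bellman recursion, and the supremum over
    schedulers commutes with the supremum over the horizon [n], because the
    expectation of [T] is the sum of the probabilities of [T > k].  Hence
    [Tbar] is the supremum of the values, and each ranking inequality is the
    limit of an inequality between values; for calls this is the
    superadditivity [value m w1 + value n w2 <= value (m + n) (w1 ++ w2)].
    That the supremum is attained horizon by horizon requires the run measure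
    of a scheduler to exist.  As there are countably many states, it can be
    obtained from the Lebesgue measure: split [0, 1[ into half-open intervals
    whose lengths are the probabilities of the first state, split these
    according to the second state, and so on; a point of [0, 1[ then encodes
    the run whose prefixes index the intervals that contain it. *)

From HB Require Import structures.
Require Import Defs.
From mathcomp Require Import all_boot all_order all_algebra.
From mathcomp Require Import all_classical all_reals all_analysis.

Set Implicit Arguments.
Unset Strict Implicit.
Unset Printing Implicit Defensive.

Import Order.TTheory GRing.Theory Num.Theory.
Local Open Scope classical_set_scope.
Local Open Scope ring_scope.

(** * Unordered sums over countable types *)

Section Esum.
Local Open Scope ereal_scope.
Variable R : realType.

Lemma esumZl (T : choiceType) (I : set T) (c : R) (a : T -> \bar R) :
  (0 <= c)%R -> (forall i, 0 <= a i) ->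
  \esum_(i in I) (c%:E * a i) = c%:E * \esum_(i in I) a i.
Proof.
move=> c0 a0; rewrite /esum -ereal_supZl//; last first.
  apply/set0P; exists (\sum_(i \in set0) a i), set0 => //.
  exact: fsets_set0.
congr ereal_sup; rewrite image_comp; apply: eq_imagel => X [finX XI] /=.
by rewrite ge0_mule_fsumr.
Qed.

(** Numbers that code no element contribute 0, so the unordered sum becomes a series over [nat],
    where limits and sigma-additivity apply. *)
Lemma esum_pickle (T : countType) (a : T -> \bar R) : (forall i, 0 <= a i) ->
  \sum_(0 <= n <oo) (if pickle_inv n is Some i then a i else 0) =
  \esum_(i in [set: T]) a i.
Proof.
move=> a0; rewrite nneseries_esumT; last by move=> n; case: pickle_inv.
rewrite (esumID (range (@pickle T))); last by move=> n _; case: pickle_inv.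
rewrite setTI [X in _ + X]esum1 ?adde0; last first.
  move=> n [_ nr]; case: (pickle_inv n) (@pickle_invK T n) => // i /= in_.
  by case: nr; exists i.
rewrite esum_image; last by move=> i j _ _; exact: (pcan_inj pickleK).
by apply: eq_esum => i _; rewrite pickleK_inv.
Qed.

Lemma measure_bigcup_esum d (S : sigmaRingType d)
    (mu : {measure set S -> \bar R}) (T : countType) (F : T -> set S) :
  (forall i, measurable (F i)) -> trivIset setT F ->
  mu (\bigcup_i F i) = \esum_(i in [set: T]) mu (F i).
Proof.
move=> mF tF; rewrite -esum_pickle//.
pose G n := if @pickle_inv T n is Some i then F i else set0.
rewrite (_ : \bigcup_i F i = \bigcup_n G n); last first.
  apply/seteqP; split=> x [n _ Fx].
    by exists (pickle n); rewrite // /G pickleK_inv.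
  by move: Fx; rewrite /G; case: pickle_inv => // i Fx; exists i.
rewrite measure_bigcup; first last.
- move=> m n _ _; rewrite /G.
  case: (pickle_inv m) (@pickle_invK T m) => [i /= <-|_ [x []//]].
  case: (pickle_inv n) (@pickle_invK T n) => [j /= <-|_ [x []//]].
  by move=> /tF ->.
- by move=> n _; rewrite /G; case: pickle_inv.
congr (limn _); apply/funext => k.
apply: eq_big => [n|n _]; first exact: in_setT.
by rewrite /G; case: pickle_inv => //; rewrite measure0.
Qed.

End Esum.

(** * Sampling *)

Section Sampling.
Local Open Scope ereal_scope.
Variable R : realType.

(** Induction on [r]: a function vanishing off [x :: r] is its value at [x] together with a function
    vanishing off [r], so the sum factors by Tonelli. *)
Lemma esum_prod_ffun (V : finType) (p : V -> int -> R) (r : seq V) : uniq r ->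
  (forall v z, 0 <= p v z)%R ->
  (forall v, \esum_(z in [set: int]) (p v z)%:E = 1) ->
  \esum_(f in [set f : {ffun V -> int} | forall v, v \notin r -> f v = 0%R])
    (\prod_(v <- r) p v (f v))%:E = 1.
Proof.
move=> + p0 p1; elim: r => [_|x r ih /=/andP[xr ur]].
  rewrite (_ : [set _ | _] = [set [ffun=> 0%R]]); last first.
    apply/seteqP; split=> f /=; last by move=> -> v _; rewrite ffunE.
    by move=> f0; apply/ffunP => v; rewrite ffunE f0.
  by rewrite esum_set1 big_nil ?lee_fin.
pose e (k : int * {ffun V -> int}) : {ffun V -> int} :=
  [ffun v => if v == x then k.1 else k.2 v].
have ex k : e k x = k.1 by rewrite ffunE eqxx.
have er k v : v != x -> e k v = k.2 v by rewrite ffunE => /negbTE ->.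
have eb : set_bij
    ([set: int] `*``
       fun=> [set f : {ffun V -> int} | forall v, v \notin r -> f v = 0%R])
    [set f : {ffun V -> int} | forall v, v \notin x :: r -> f v = 0%R] e.
  split.
  - move=> [z f] [_ /= f0] v; rewrite inE negb_or => /andP[vx vr].
    by rewrite er//= f0.
  - move=> [z f] [z' f'] /=; rewrite !inE/= => -[_ f0] [_ f'0] /ffunP ee.
    congr (_, _); first by have := ee x; rewrite !ex.
    apply/ffunP => v; have [->|vx] := eqVneq v x; first by rewrite f0 ?f'0.
    by have := ee v; rewrite !er.
  - move=> f f0; exists (f x, [ffun v => if v == x then 0%R else f v]) => /=.
      split=> // v vr; rewrite ffunE; case: eqVneq => // vx.
      by apply: f0; rewrite inE negb_or vx.
    apply/ffunP => v; rewrite ffunE /=; case: eqVneq => [->//|vx].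
    by rewrite ffunE (negbTE vx).
rewrite (@reindex_esum _ _ _ _ _ e _ eb) -[RHS](p1 x).
have pr0 (f : {ffun V -> int}) : 0 <= (\prod_(v <- r) p v (f v))%:E.
  by rewrite lee_fin; apply: prodr_ge0 => v _.
transitivity (\esum_(z in [set: int])
    \esum_(f in [set f : {ffun V -> int} | forall v, v \notin r -> f v = 0%R])
      ((p x z)%:E * (\prod_(v <- r) p v (f v))%:E)).
  rewrite esum_esum => [|z f _ _]; last by apply: mule_ge0; rewrite // lee_fin p0.
  apply: eq_esum => k _; rewrite big_cons ex EFinM.
  rewrite (eq_big_seq (fun v => p v (k.2 v)))// => v vr.
  by rewrite er//; apply: contraNneq xr => <-.
by apply: eq_esum => z _; rewrite esumZl// ih// mule1.
Qed.

Variables (W : program) (U : sampling R W).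

Lemma joint_ge0 mu : (0 <= joint U mu)%R.
Proof. by apply: prodr_ge0 => r _; exact: Defs.pmf_ge0. Qed.

Lemma joint_esum1 :
  \esum_(mu in [set: {ffun svar W -> int}]) (joint U mu)%:E = 1.
Proof.
rewrite -(@esum_prod_ffun (svar W) U (index_enum (svar W)))//.
- congr (esum _ _); apply/seteqP; split=> // f _ v.
  by rewrite mem_index_enum.
- exact: index_enum_uniq.
- by move=> v z; exact: Defs.pmf_ge0.
- by move=> v; exact: Defs.pmf_sum1.
Qed.

End Sampling.

(** * Finite-horizon values *)

Section Value.
Local Open Scope ereal_scope.
Variables (R : realType) (W : program) (U : sampling R W).
Implicit Types (w : config W) (a : action).

Definition next_mean (G : config W -> \bar R) w a : \bar R :=
  \esum_(mu in [set: {ffun svar W -> int}])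
    ((joint U mu)%:E * G (next_config w a mu)).

Lemma next_mean_ge0 G w a : (forall w, 0 <= G w) -> 0 <= next_mean G w a.
Proof.
by move=> G0; apply: esum_ge0 => mu _; rewrite mule_ge0 ?lee_fin ?joint_ge0.
Qed.

Lemma le_next_mean G H w w' a :
  (forall mu, G (next_config w a mu) <= H (next_config w' a mu)) ->
  next_mean G w a <= next_mean H w' a.
Proof.
by move=> GH; apply: le_esum => mu _; rewrite lee_wpmul2l ?lee_fin ?joint_ge0.
Qed.

(** The constant passes through because [joint U] has total mass 1. *)
Lemma next_mean_addr G w a (c : R) : (forall w, 0 <= G w) -> (0 <= c)%R ->
  next_mean (fun w => G w + c%:E) w a = next_mean G w a + c%:E.
Proof.
move=> G0 c0; have J0 mu : 0 <= (joint U mu)%:E by rewrite lee_fin joint_ge0.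
rewrite -[X in _ + X]mule1 -(joint_esum1 U) -esumZl// -esumD; last first.
- by move=> mu _; apply: mule_ge0; rewrite // lee_fin.
- by move=> mu _; apply: mule_ge0.
by apply: eq_esum => mu _; rewrite ge0_muleDr ?lee_fin// [X in _ + X]muleC.
Qed.

(* The optimal expectation of [min (T, n)]; outside nondeterministic labels
   [next_config] does not depend on the action, so that [Th] and [El] cover
   all cases. *)
Fixpoint value n w : \bar R :=
  match n, w with
  | m.+1, _ :: _ =>
      1 + maxe (next_mean (value m) w Th) (next_mean (value m) w El)
  | _, _ => 0
  end.

Lemma value_cons n d w : value n.+1 (d :: w) =
  1 + maxe (next_mean (value n) (d :: w) Th) (next_mean (value n) (d :: w) El).
Proof. by []. Qed.

Lemma value_nil n : value n [::] = 0.
Proof. by case: n. Qed.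

Lemma value_ge0 n w : 0 <= value n w.
Proof.
elim: n w => [|n ih] [|d w]//.
by rewrite value_cons adde_ge0// le_max next_mean_ge0.
Qed.
Hint Resolve value_ge0 : core.

Lemma value_le_succ n w : value n w <= value n.+1 w.
Proof.
elim: n w => [|n ih] w; first exact: value_ge0.
case: w => [|d w]; first by rewrite !value_nil.
rewrite !value_cons leeD2l// ge_max !le_max.
by rewrite !le_next_mean ?orbT// => mu; exact: ih.
Qed.

Lemma value_homo w : {homo value^~ w : m n / (m <= n)%N >-> m <= n}.
Proof.
by apply: homo_leq => [//|y x z|n]; [exact: le_trans|exact: value_le_succ].
Qed.

(** One more unit of horizon earns at most one step; the induction carries the added 1 through the
    mean and the maximum. *)
Lemma value_succ_le n w : value n.+1 w <= value n w + 1.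
Proof.
elim: n w => [|n ih] [|d w]; rewrite ?value_nil ?add0e//.
  rewrite value_cons -[leRHS]adde0 leeD2l// ge_max.
  by rewrite /next_mean !esum1 ?lexx// => mu _; rewrite mule0.
rewrite !value_cons -addeA leeD2l// adde_maxl.
rewrite ge_max !le_max -!next_mean_addr//.
by rewrite !le_next_mean ?orbT// => mu; exact: ih.
Qed.

Lemma value_le n w : value n w <= n%:R%:E.
Proof.
elim: n => [//|n ih]; apply: (le_trans (value_succ_le _ _)).
by rewrite -natr1 EFinD leeD2r.
Qed.

Lemma value_fin_num n w : value n w \is a fin_num.
Proof. by rewrite ge0_fin_numE// (le_lt_trans (value_le _ _))// ltry. Qed.

Lemma push_cat d w w' : push d (w ++ w') = push d w ++ w'.
Proof. by rewrite /push; case: insubP. Qed.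

Lemma next_config_cat d w w' a mu :
  next_config ((d :: w) ++ w') a mu = next_config (d :: w) a mu ++ w'.
Proof.
case: d => -[f [l nu]] dl /=.
by case: (instr l) => *; rewrite ?push_cat.
Qed.

(** Elements on top of [w2] only delay it: a step spent on them earns 1, which makes up for the unit
    of horizon lost by [value_succ_le], and leaves [w2] intact at the bottom. *)
Lemma value_cat0 n w1 w2 : value n w2 <= value n (w1 ++ w2).
Proof.
elim: n w1 => [//|n ih] [//|d w1].
apply: (le_trans (value_succ_le _ _)); rewrite addeC.
rewrite [leRHS]value_cons leeD2l// le_max; apply/orP; left.
have c0 : (0 <= fine (value n w2))%R by rewrite fine_ge0.
(* The constant is written as [0 + c] so that [next_mean_addr] evaluates its mean. *)
rewrite -[leLHS](_ :
    next_mean (fun=> 0 + (fine (value n w2))%:E) (d :: w1) Th = _).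
  apply: le_next_mean => mu.
  by rewrite add0e fineK ?value_fin_num// -cat_cons next_config_cat.
rewrite next_mean_addr// fineK ?value_fin_num//.
rewrite /next_mean esum1 ?add0e// => mu _.
by rewrite mule0.
Qed.

Lemma value_cat m n w1 w2 : value m w1 + value n w2 <= value (m + n) (w1 ++ w2).
Proof.
elim: m w1 => [|m ih] w1; first by rewrite add0e add0n value_cat0.
case: w1 => [|d w1].
  by rewrite value_nil add0e value_homo// leq_addl.
have c0 : (0 <= fine (value n w2))%R by rewrite fine_ge0.
rewrite addSn value_cons -addeA [leRHS]value_cons leeD2l//.
rewrite -(fineK (value_fin_num n w2)) adde_maxl -!next_mean_addr//.
rewrite ge_max !le_max fineK ?value_fin_num// -cat_cons.
by rewrite !le_next_mean ?orbT// => mu; rewrite next_config_cat ih.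
Qed.

End Value.

(** * One step under a scheduler *)

Section Steps.
Local Open Scope ereal_scope.
Variables (R : realType) (W : program) (U : sampling R W).
Implicit Types (s : state W) (t : seq (state W)) (a : action).
Implicit Types sigma : scheduler U.

Lemma trans_ge0 s a s' : (0 <= trans U s a s')%R.
Proof. by rewrite /trans; case: ifP => // _; exact: joint_ge0. Qed.

Lemma step_ge0 sigma s t s' : history U s t -> (0 <= Defs.step sigma s t s')%R.
Proof.
move=> st; apply: sumr_ge0 => a _.
by rewrite mulr_ge0 ?trans_ge0// sched_ge0.
Qed.

(** Under an enabled action the next state is determined by its sampling valuation, so the mass sits
    on the graph of [next_config]. *)
Lemma esum_trans s a (G : state W -> \bar R) : enabled s a ->
  (forall s', 0 <= G s') ->
  \esum_(s' in [set: state W]) ((trans U s a s')%:E * G s') =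
  \esum_(mu in [set: {ffun svar W -> int}])
    ((joint U mu)%:E * G (next_config s.1 a mu, mu)).
Proof.
move=> sa G0; pose e mu : state W := (next_config s.1 a mu, mu).
rewrite (esumID (range e)); last first.
  by move=> s' _; rewrite mule_ge0 ?lee_fin ?trans_ge0.
rewrite setTI [X in _ + X]esum1 ?adde0; last first.
  move=> [w mu] [_ /= wmu]; rewrite /trans sa/=; case: eqP => [we|_].
    by case: wmu; exists mu => //; rewrite /e -we.
  by rewrite mul0e.
rewrite esum_image; last by move=> mu mu' _ _ [].
by apply: eq_esum => mu _; rewrite /trans sa/= eqxx.
Qed.

Lemma esum_step sigma s t (G : state W -> \bar R) : history U s t ->
  (forall s', 0 <= G s') ->
  \esum_(s' in [set: state W]) ((Defs.step sigma s t s')%:E * G s') =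
  \sum_(a : action) (sigma s t a)%:E *
    \esum_(mu in [set: {ffun svar W -> int}])
      ((joint U mu)%:E * G (next_config (last s t).1 a mu, mu)).
Proof.
move=> st G0; have sg a : (0 <= sigma s t a)%R by rewrite sched_ge0.
have tG a s' : 0 <= (trans U (last s t) a s')%:E * G s'.
  by rewrite mule_ge0 ?lee_fin ?trans_ge0.
transitivity (\esum_(s' in [set: state W]) \sum_(a : action)
    (sigma s t a)%:E * ((trans U (last s t) a s')%:E * G s')).
  apply: eq_esum => s' _; rewrite /Defs.step -sumEFin ge0_sume_distrl.
    by apply: eq_bigr => a _; rewrite EFinM muleA.
  by move=> a _; rewrite lee_fin mulr_ge0// trans_ge0.
rewrite esum_sum; last by move=> s' a _ _; rewrite mule_ge0 ?lee_fin.
apply: eq_bigr => a _; rewrite esumZl//.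
(* For a disabled action the mean on the right need not vanish, but its weight under [sigma] is
   0. *)
have [la|la] := boolP (enabled (last s t) a); first by rewrite esum_trans.
by rewrite sched_enabled// !mul0e.
Qed.

Lemma step_esum1 sigma s t : history U s t ->
  \esum_(s' in [set: state W]) (Defs.step sigma s t s')%:E = 1.
Proof.
move=> st; under eq_esum do rewrite -[_%:E]mule1.
rewrite esum_step// -[RHS](_ : (\sum_(a : action) sigma s t a)%:E = _).
  rewrite -sumEFin; apply: eq_bigr => a _; under eq_esum do rewrite mule1.
  by rewrite joint_esum1 mule1.
by rewrite sched_sum1.
Qed.

Lemma history_rcons s t s' a :
  history U s t -> (0 < trans U (last s t) a s')%R -> history U s (rcons t s').
Proof.
move=> st ps; rewrite /history rcons_path; apply/andP; split => //.
by apply/existsP; exists a.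
Qed.

Lemma step_notin_history sigma s t s' : ~~ history U s (rcons t s') ->
  history U s t -> Defs.step sigma s t s' = 0%R.
Proof.
move=> sts' st; apply: big1 => a _; have := trans_ge0 (last s t) a s'.
rewrite le_eqVlt => /predU1P[<-|/(history_rcons st)]; first by rewrite mulr0.
by rewrite (negbTE sts').
Qed.

End Steps.

(** * Existence of run measures *)

Section RunMeasure.
Variables (R : realType) (W : program).
(* [p r s] is the probability that [s] follows the states of [r], which are
   listed in reverse order, the most recent one first. *)
Variable p : seq (state W) -> state W -> R.
Hypothesis p_ge0 : forall r s, 0 <= p r s.
Hypothesis p_sum1 : forall r, (\esum_(s in [set: state W]) (p r s)%:E = 1)%E.
Implicit Types (r t : seq (state W)) (s : state W) (x : R).

(** States are ordered by their [pickle] codes; a number that codes no state has mass 0. *)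
Let mass r n : R := if pickle_inv n is Some s then p r s else 0.
Let cdf r n : R := \sum_(0 <= k < n) mass r k.

Let mass_ge0 r n : 0 <= mass r n.
Proof. by rewrite /mass; case: pickle_inv. Qed.

Let mass_pickle r s : mass r (pickle s) = p r s.
Proof. by rewrite /mass pickleK_inv. Qed.

Let cdfS r n : cdf r n.+1 = cdf r n + mass r n.
Proof. by rewrite /cdf big_nat_recr. Qed.

Let cdf_homo r : {homo cdf r : m n / (m <= n)%N >-> m <= n}.
Proof.
apply: homo_leq => [//|y x z|n]; first exact: le_trans.
by rewrite cdfS lerDl.
Qed.

Let mass_sum1 r : (\sum_(0 <= n <oo) (mass r n)%:E = 1)%E.
Proof.
rewrite -(p_sum1 r) -esum_pickle//; last by move=> s; rewrite lee_fin.
by apply: eq_eseriesr => n _; rewrite /mass; case: pickle_inv.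
Qed.

Let cdf_le1 r n : cdf r n <= 1.
Proof.
rewrite -lee_fin -(mass_sum1 r) /cdf -sumEFin.
by apply: nneseries_lim_ge => k _; rewrite lee_fin.
Qed.

(** The partial sums need not attain 1; this form serves to show that the subintervals exhaust their
    parent. *)
Let cdf_sup r b : (forall n, cdf r n <= b) -> 1 <= b.
Proof.
move=> cb; rewrite -lee_fin -(mass_sum1 r); apply: lime_le.
  by apply: is_cvg_nneseries => n _ _; rewrite lee_fin.
by apply: nearW => n; rewrite sumEFin lee_fin; exact: cb.
Qed.

Fixpoint prefix_prob r : R :=
  if r is s :: r' then prefix_prob r' * p r' s else 1.

(** The left endpoint of the interval of a prefix: inside the parent, the subintervals of the states
    with smaller codes come first. *)
Let lo := fix lo r : R :=
  if r is s :: r' then lo r' + prefix_prob r' * cdf r' (pickle s) else 0.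

Let itv r : set (measurableTypeR R) := `[lo r, lo r + prefix_prob r[%classic.

Lemma prefix_prob_ge0 r : 0 <= prefix_prob r.
Proof. by elim: r => //= s r ih; rewrite mulr_ge0. Qed.

Let itv_cons r s x : itv (s :: r) x =
  (lo r + prefix_prob r * cdf r (pickle s) <= x
   < lo r + prefix_prob r * cdf r (pickle s).+1) :> Prop.
Proof. by rewrite /itv /= in_itv/= cdfS mass_pickle mulrDr addrA. Qed.

Let itv_sub r s : itv (s :: r) `<=` itv r.
Proof.
move=> x; rewrite itv_cons => /andP[lx xl]; rewrite /itv /= in_itv/=.
rewrite (le_trans _ lx) ?lerDl ?mulr_ge0 ?prefix_prob_ge0 ?sumr_ge0//=.
by rewrite (lt_le_trans xl)// lerD2l ler_piMr ?prefix_prob_ge0.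
Qed.

Let itv_sub0 r : itv r `<=` itv [::].
Proof. by elim: r => // s r ih; exact: subset_trans (@itv_sub _ _) ih. Qed.

Let itv_inj r s s' x : itv (s :: r) x -> itv (s' :: r) x -> s = s'.
Proof.
wlog ss' : s s' / (pickle s < pickle s')%N => [wlg|].
  have [/wlg|/wlg h a b|/(pcan_inj pickleK)//] := ltngtP (pickle s) (pickle s').
    exact.
  by rewrite (h b a).
rewrite !itv_cons => /andP[_ xs] /andP[s'x _].
have := le_lt_trans s'x xs; rewrite ltrD2l ltNge ler_wpM2l ?prefix_prob_ge0//.
exact: cdf_homo.
Qed.

Let itv_cover r x : itv r x -> exists s, itv (s :: r) x.
Proof.
rewrite {1}/itv /= in_itv/= => /andP[lx xl].
have xc : exists n, x < lo r + prefix_prob r * cdf r n.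
  (* If [x] were beyond every partial endpoint, its relative position in the interval would bound
     all of [cdf r], hence be at least 1, against [x] being left of the right endpoint. *)
  apply: contrapT => /forallNP xn.
  have p0 : 0 < prefix_prob r.
    by rewrite -(ltrD2l (lo r)) addr0 (le_lt_trans lx).
  have : 1 <= (x - lo r) / prefix_prob r.
    apply: (@cdf_sup r) => n; rewrite ler_pdivlMr// lerBrDl mulrC leNgt.
    exact/negP/xn.
  by rewrite ler_pdivlMr// mul1r lerBrDl leNgt xl.
case: (ex_minnP xc) => -[|m].
  by rewrite /cdf big_geq// mulr0 addr0 ltNge lx.
move=> xm mmin {xc}.
have mx : lo r + prefix_prob r * cdf r m <= x.
  by rewrite leNgt; apply/negP => /mmin; rewrite ltnn.
(* By minimality [x] separates two consecutive endpoints, so [mass r m] is nonzero and [m] codes a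
   state. *)
have := le_lt_trans mx xm; rewrite ltrD2l cdfS mulrDr ltrDl /mass.
case: (pickle_inv m) (@pickle_invK (state W) m) => [s /= sm _|]; last first.
  by rewrite mulr0 ltxx.
by exists s; rewrite itv_cons sm mx.
Qed.

(** The prefix encoded by [x], in reverse order. [xget] falls back on [point] when no subinterval
    contains [x], which happens exactly outside [[0, 1[]. *)
Let hist x := fix hist n : seq (state W) :=
  if n is m.+1 then
    let r := hist m in xget point [set s | itv (s :: r) x] :: r
  else [::].

Let itv_hist x n : itv [::] x -> itv (hist x n) x.
Proof.
move=> x01; elim: n => //= n /itv_cover[s sx].
by case: xgetP => [s' _ //|/(_ s)].
Qed.

Let hist_itv x r : itv r x -> hist x (size r) = r.
Proof.
elim: r => //= s r ih srx; rewrite (ih (itv_sub srx)); congr (_ :: _).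
by case: xgetP => [s' _ /itv_inj/(_ srx)//|/(_ s)].
Qed.

Let histN x n : ~ itv [::] x -> hist x n = nseq n point.
Proof.
move=> x01; elim: n => //= n ->; congr (_ :: _).
by case: xgetP => // s _ /itv_sub0.
Qed.

Let run (x : measurableTypeR R) : runs W := fun n => head point (hist x n.+1).

Let take_run x n : rev (hist x n) = mkseq (run x) n.
Proof.
by elim: n => // n ih; rewrite -addn1 /mkseq iotaD map_cat -/(mkseq _ _) -ih
  addn1/= rev_cons -cats1.
Qed.

(** The second set accounts for the points outside [[0, 1[], all of which encode the run constantly
    equal to [point]. *)
Let run_cylinder s t : run @^-1` cylinder s t =
  itv (rev (s :: t)) `|`
  (~` itv [::] `&` [set _ | rev (s :: t) == nseq (size t).+1 point]).
Proof.
have runE x : (run @^-1` cylinder s t) x <-> hist x (size t).+1 = rev (s :: t).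
  split=> [xst|xst i it].
    rewrite -[LHS]revK take_run; congr rev.
    apply: (@eq_from_nth _ point) => [|i]; rewrite size_mkseq// => it.
    by rewrite nth_mkseq// xst//; apply: set_nth_default.
  have := take_run x (size t).+1; rewrite xst revK => ->.
  by rewrite nth_mkseq.
apply/seteqP; split=> x.
  move=> /runE; have [x01|x01] := pselect (itv [::] x).
    by move=> <-; left; exact: itv_hist.
  by rewrite histN// => <-; right; rewrite /= eqxx.
case=> [|[x01 /= /eqP st]]; last by apply/runE; rewrite histN.
by move=> /hist_itv; rewrite size_rev => xst; exact/runE.
Qed.

Let mitv r : measurable (itv r).
Proof. exact: measurable_itv. Qed.

Let measurable_off_itv (b : bool) : measurable (~` itv [::] `&` [set _ | b]).
Proof.
by case: b; rewrite ?set_true ?set_false ?setIT ?setI0//; exact: measurableC.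
Qed.

Let measurable_run : measurable_fun setT run.
Proof.
apply: (@measurability _ _ _ (runs W) _ _ (@cylinders W)) => //.
move=> _ [_ [[s t] _ <-] <-].
by rewrite setTI run_cylinder; exact: measurableU.
Qed.

Let lebesgue_itv r : lebesgue_measure (itv r) = (prefix_prob r)%:E.
Proof.
rewrite lebesgue_measure_itv/= lte_fin ltrDl -EFinB addrC addKr.
case: ltP => // p0; congr (_%:E); apply/eqP.
by rewrite eq_le prefix_prob_ge0.
Qed.

Let unif : probability (measurableTypeR R) R := uniform_prob (@ltr01 R).

Let unif_itv r : unif (itv r) = (prefix_prob r)%:E.
Proof.
rewrite /unif /= /uniform_prob.
rewrite (eq_integral (cst 1%E)) => [|x /[!inE] /itv_sub0].
  by rewrite integral_cst ?mul1e; [exact: lebesgue_itv|exact: mitv].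
rewrite /itv /= in_itv/= add0r => /andP[x0 x1].
by rewrite /uniform_pdf x0 ltW// subr0 invr1.
Qed.

HB.instance Definition _ := isMeasurableFun.Build _ _ _ _ run measurable_run.

Lemma run_measure_exists : exists P : probability (runs W) R,
  forall s t, P (cylinder s t) = (prefix_prob (rev (s :: t)))%:E.
Proof.
exists (distribution unif run) => s t.
have mJ := measurable_off_itv (rev (s :: t) == nseq (size t).+1 point).
rewrite /distribution/= /pushforward run_cylinder measureU//; last first.
  by apply/seteqP; split=> x // [/itv_sub0 x01 []].
rewrite -[RHS]adde0; congr (_ + _)%E; first exact: unif_itv.
(* The part from outside [[0, 1[] is a null set for the uniform law. *)
apply: (@subset_measure0 _ _ _ _ _ (~` itv [::])) => //.
  exact: measurableC.
by have := @probability_setC _ _ _ unif _ (mitv [::]); rewrite unif_itv subee.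
Qed.

End RunMeasure.

(** * Termination time as a series *)

Section ExpectedTime.
Local Open Scope ereal_scope.
Variables (R : realType) (W : program) (U : sampling R W).
Implicit Types (s : state W) (t : seq (state W)) (sigma : scheduler U).

Lemma esum_dirac (s0 : state W) :
  \esum_(s in [set: state W]) ((s == s0)%:R : R)%:E = 1.
Proof.
rewrite (esumID [set s0]); last by move=> s _; rewrite lee_fin.
rewrite setTI esum_set1 ?lee_fin// eqxx esum1 ?adde0// => s [_ /= /eqP].
by move=> /negbTE ->.
Qed.

Lemma induced_measure_exists sigma (c : elem W) :
  exists P : probability (runs W) R, induced_measure sigma c P.
Proof.
(* Prefixes come in reverse. Off histories [sigma] need not give a probability, so a Dirac mass
   keeps the total mass 1 there. *)
pose p r s : R := if rev r is s0 :: t then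
  if history U s0 t then Defs.step sigma s0 t s else (s == s0)%:R
  else (s == init c)%:R.
have p_ge0 r s : (0 <= p r s)%R.
  rewrite /p; case: rev => // s0 t; case: ifP => // st.
  exact: step_ge0.
have p_sum1 r : \esum_(s in [set: state W]) (p r s)%:E = 1.
  rewrite /p; case: rev => [|s0 t]; first exact: esum_dirac.
  case: (boolP (history U s0 t)) => st; last exact: esum_dirac.
  exact: step_esum1.
have [P PE] := run_measure_exists p_ge0 p_sum1.
exists P; split=> [s|s t s' st]; first by rewrite PE /= mul1r.
by rewrite !PE -rcons_cons rev_rcons /= {2}/p revK st EFinM.
Qed.

Lemma cylinder_last s t (w : runs W) : cylinder s t w -> w (size t) = last s t.
Proof. by move=> -> //; rewrite nth_last. Qed.

Lemma cylinder_rcons s t s' :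
  cylinder s (rcons t s') = cylinder s t `&` [set w | w (size t).+1 = s'].
Proof.
apply/seteqP; split=> w.
  move=> ws; split=> [i it|/=].
    by rewrite ws ?size_rcons ?(leq_trans it)// -rcons_cons nth_rcons/= ltnS it.
  by rewrite ws ?size_rcons// -rcons_cons nth_rcons/= ltnn eqxx.
move=> [wt ws] i; rewrite size_rcons leq_eqVlt ltnS => /predU1P[->|it].
  by rewrite ws -rcons_cons nth_rcons/= ltnn eqxx.
by rewrite wt// -rcons_cons nth_rcons/= ltnS it.
Qed.

Lemma measurable_cylinder s t : measurable (cylinder s t : set (runs W)).
Proof. by apply: sub_sigma_algebra; exists (s, t). Qed.

(** [alive 0 k.+1] is the event [T > k]. Asking for all times of the window makes this right even
    for sequences that leave the empty configuration again; a positive [m] serves inductions that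
    start in mid-run. *)
Definition alive m n : set (runs W) :=
  [set w | forall i, (m <= i < n)%N -> (w i).1 <> [::]].

Lemma measurable_alive m n : measurable (alive m n).
Proof.
pose coord i : set (runs W) := [set w | (w i).1 <> [::]].
have mcoord i : measurable (coord i).
  pose F (st : state W * seq (state W)) : set (runs W) :=
    if (size st.2 == i) && ((last st.1 st.2).1 != [::])
    then cylinder st.1 st.2 else set0.
  rewrite (_ : coord i = \bigcup_st F st).
    apply: countable_bigcupT_measurable => [|st]; first exact: countableP.
    by rewrite /F; case: ifP => // _; exact: measurable_cylinder.
  apply/seteqP; split=> w.
    move=> wi; exists (w 0%N, mkseq (fun k => w k.+1) i) => //.
    have cw : cylinder (w 0%N) (mkseq (fun k => w k.+1) i) w.
      by case=> [//|k]; rewrite size_mkseq /= => ki; rewrite nth_mkseq.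
    by rewrite /F size_mkseq eqxx -(cylinder_last cw) size_mkseq; case: eqP.
  move=> [[s t] _]; rewrite /F /=; case: ifP => // /andP[/eqP <- /eqP lst].
  by move=> /cylinder_last wt; rewrite /coord/= wt.
rewrite (_ : alive m n =
    \bigcap_i (if (m <= i < n)%N then coord i else setT)); last first.
  apply/seteqP; split=> w wa i; first by move=> _; case: ifP => // /wa.
  by move=> mi; have := wa i I; rewrite mi.
by apply: bigcapT_measurable => i; case: ifP.
Qed.

Lemma termination_time_alive (w : runs W) :
  termination_time R w = \sum_(0 <= k <oo) (\1_(alive 0 k.+1) w : R)%:E.
Proof.
have [wN|] := pselect (exists n, (w n).1 == [::]).
  case: (ex_minnP wN) => {wN}N /eqP wN minN.
  have aliveE k : \1_(alive 0 k.+1) w = (k < N)%:R :> R.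
    rewrite indicE; congr (_%:R); congr nat_of_bool; apply/idP/idP => [|kN].
      by rewrite inE => wk; rewrite ltnNge; apply/negP => Nk; exact: (wk N).
    rewrite inE => i /= ik wi; have /minN := introT eqP wi.
    by rewrite leqNgt (leq_trans ik).
  rewrite (nneseries_split 0 N) => [|k _]; last by rewrite lee_fin.
  rewrite add0n [X in _ + X]eseries0 ?adde0; last first.
    by move=> k Nk _; rewrite aliveE ltnNge Nk.
  rewrite (eq_big_nat _ _ (F2 := fun=> 1)); last first.
    by move=> k /andP[_ kN]; rewrite aliveE kN.
  rewrite sumEFin big_const_nat subn0 iter_addr_0.
  apply/eqP; rewrite eq_le; apply/andP; split.
    by apply: ereal_inf_lbound; exists N.
  apply: le_ereal_inf_tmp => _ [m /= wm <-].
  by rewrite lee_fin ler_nat; apply/minN/eqP.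
move=> /forallNP wn.
rewrite /termination_time [X in ereal_inf X](_ : _ = set0).
  rewrite ereal_inf0; apply/esym.
  rewrite (eq_eseriesr (g := fun=> 1)); last first.
    by move=> k _; rewrite indicE mem_set// => i _; apply/eqP/negP/wn.
  (* Without termination every indicator is 1, and the partial sums exceed any real [r]. *)
  apply: eq_infty => r; 
  have := @nneseries_lim_ge R (fun=> 1) xpredT 0 (Num.truncn r).+1.
  move=> /(_ (fun _ _ _ => lee01)); apply: le_trans.
  by rewrite sumEFin big_const_nat subn0 iter_addr_0 lee_fin ltW// truncnS_gt.
by apply/seteqP; split=> // _ [m /= wm _]; have := wn m; rewrite wm eqxx.
Qed.

End ExpectedTime.

(** * Schedulers versus finite-horizon values *)

Section Optimality.
Local Open Scope ereal_scope.
Variables (R : realType) (W : program) (U : sampling R W).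
Implicit Types (s : state W) (t : seq (state W)) (a : action).
Implicit Types sigma : scheduler U.

(* The expectation under [sigma] of the number of steps before [T] among the
   next [n].  The test on histories discards the successors outside histories,
   where the values of [sigma] could be negative. *)
Fixpoint policy_value sigma n s t : \bar R :=
  match n, (last s t).1 with
  | m.+1, _ :: _ => 1 + \esum_(s' in [set: state W])
      ((Defs.step sigma s t s')%:E *
       if history U s (rcons t s') then policy_value sigma m s (rcons t s')
       else 0)
  | _, _ => 0
  end.

Lemma policy_value_ge0 sigma n s t : history U s t ->
  0 <= policy_value sigma n s t.
Proof.
elim: n t => [//|n ih] t st /=; case: (last s t).1 => // _ _.
rewrite adde_ge0// esum_ge0// => s' _.
case: ifP => [/ih pv|]; last by rewrite mule0.
by rewrite mule_ge0// lee_fin step_ge0.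
Qed.

(** * Expectations under the run measure of a scheduler *)

Section Measure.
Variables (sigma : scheduler U) (c : elem W) (P : probability (runs W) R).
Hypothesis P_ind : induced_measure sigma c P.

(** If the current configuration is nonempty, the first summand is the whole cylinder and each later
    one is split by the next state, which reduces the horizon by one. *)
Lemma sum_alive_policy_value n s t : history U s t ->
  \sum_(k < n) P (cylinder s t `&` alive (size t) (size t + k.+1)) =
  P (cylinder s t) * policy_value sigma n s t.
Proof.
elim: n t => [|n ih] t st; first by rewrite big_ord0 mule0.
rewrite /=; case lstE : (last s t).1 => [|d w].
  rewrite mule0; apply: big1 => k _; rewrite -[RHS](measure0 P); congr (P _).
  apply/seteqP; split=> x // [/cylinder_last xt /(_ (size t))].
  by rewrite leqnn addnS ltnS leq_addr xt lstE => /(_ isT).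
have alive1 k : cylinder s t `&` alive (size t) (size t + k.+1) =
    cylinder s t `&` alive (size t).+1 (size t + k.+1).
  apply/seteqP; split=> x [xt xa]; split=> // i /andP[ti ik].
    by apply: xa; rewrite ltnW.
  move: ti; rewrite leq_eqVlt => /predU1P[<-|ti]; last by apply: xa; rewrite ti.
  by rewrite (cylinder_last xt) lstE.
pose F k s' : set (runs W) := cylinder s (rcons t s') `&`
  alive (size (rcons t s')) (size (rcons t s') + k.+1).
have mF k s' : measurable (F k s').
  by apply: measurableI; [exact: measurable_cylinder|exact: measurable_alive].
have FE k : P (cylinder s t `&` alive (size t) (size t + k.+2)) =
    \esum_(s' in [set: state W]) P (F k s').
  rewrite -measure_bigcup_esum//.
    rewrite alive1; congr (P _); apply/seteqP; split=> x.
      move=> [xt xa]; exists (x (size t).+1) => //.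
      rewrite /F cylinder_rcons size_rcons.
      by split=> //; rewrite addSnnS.
    move=> [s' _]; rewrite /F cylinder_rcons size_rcons addSnnS.
    by move=> -[[? _] ?].
  move=> s1 s2 _ _ [x []]; rewrite /F !cylinder_rcons.
  by move=> [[_ /= <-] _] [[_ /= <-] _].
rewrite big_ord_recl alive1 (_ : _ `&` alive _ _ = cylinder s t); last first.
  apply/seteqP; split=> x; first by case.
  move=> xt; split=> // i; rewrite addn1 ltnS => /andP[/leq_trans h /h].
  by rewrite ltnn.
rewrite (eq_bigr _ (fun (k : 'I_n) _ => FE k)) -esum_sum//.
have Pfin : P (cylinder s t) = (fine (P (cylinder s t)))%:E.
  by rewrite fineK// fin_num_measure//; exact: measurable_cylinder.
have P0 : (0 <= fine (P (cylinder s t)))%R by rewrite fine_ge0.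
set G := fun s' => _ * _.
have G0 s' : 0 <= G s'.
  rewrite /G; case: ifP => [h|]; last by rewrite mule0.
  by rewrite mule_ge0 ?policy_value_ge0// lee_fin step_ge0.
have GG0 : 0 <= \esum_(s' in [set: state W]) G s' by exact: esum_ge0.
rewrite ge0_muleDr// mule1; congr (_ + _).
rewrite Pfin -esumZl//; apply: eq_esum => s' _; rewrite /G muleA -Pfin.
rewrite -(P_ind.2 s t s' st); case: ifPn => [/ih ->//|sts'].
(* A successor that leaves the histories has [step] 0, so its cylinder is null. *)
rewrite mule0; apply: big1 => k _; apply/eqP.
rewrite -measure_le0 (@le_trans _ _ (P (cylinder s (rcons t s'))))//.
  apply: le_measure; rewrite ?inE//; first exact: measurable_cylinder.
  exact: subIsetl.
by rewrite P_ind.2// (step_notin_history _ sts')// mule0.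
Qed.

(** Intersecting with the cylinder of [init c] costs nothing, as it has probability 1. *)
Lemma sum_alive_init n :
  \sum_(0 <= k < n) P (alive 0 k.+1) = policy_value sigma n (init c) [::].
Proof.
have Pc : P (cylinder (init c) [::]) = 1 by rewrite P_ind.1 eqxx.
have mc : measurable (cylinder (init c) [::] : set (runs W)).
  exact: measurable_cylinder.
rewrite -[RHS]mul1e -Pc -sum_alive_policy_value// big_mkord.
apply: eq_bigr => k _; have ma := @measurable_alive W 0 k.+1.
rewrite add0n setIC (measureDI P ma mc) [X in X + _](_ : _ = 0) ?add0e//.
apply: (@subset_measure0 _ _ _ P _ (~` cylinder (init c) [::])).
- exact: measurableD.
- exact: measurableC.
- exact: subIsetr.
- by have := probability_setC P mc; rewrite Pc subee.
Qed.

Lemma expectation_termination_time :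
  \int[P]_w termination_time R w =
  \sum_(0 <= k <oo) P (alive 0 k.+1).
Proof.
under eq_integral do rewrite termination_time_alive.
rewrite integral_nneseries//; last first.
  move=> n; apply/measurable_realfun.measurable_EFinP.
  by apply: measurable_realfun.measurable_indic; exact: measurable_alive.
apply: eq_eseriesr => k _; rewrite integral_indic ?setIT//.
exact: measurable_alive.
Qed.

Lemma policy_value_le_expectation n :
  policy_value sigma n (init c) [::] <= \int[P]_w termination_time R w.
Proof.
rewrite expectation_termination_time -sum_alive_init.
by apply: nneseries_lim_ge => k _ _; exact: measure_ge0.
Qed.

Lemma expectation_le b : (forall n, policy_value sigma n (init c) [::] <= b) ->
  \int[P]_w termination_time R w <= b.
Proof.
move=> pb; rewrite expectation_termination_time; apply: lime_le.
  by apply: is_cvg_nneseries => k _ _; exact: measure_ge0.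
by apply: nearW => n; rewrite sum_alive_init.
Qed.

End Measure.

Definition best_next n s : \bar R :=
  maxe (next_mean U (value U n) s.1 Th) (next_mean U (value U n) s.1 El).

Lemma next_mean_le_best n s a : next_mean U (value U n) s.1 a <= best_next n s.
Proof.
(* [next_config] computes in the same way at [Tau] and at [El]. *)
by rewrite /best_next le_max; case: a; rewrite ?lexx ?orbT.
Qed.

Lemma esum_step_value sigma n s t : history U s t ->
  \esum_(s' in [set: state W]) ((Defs.step sigma s t s')%:E * value U n s'.1) =
  \sum_(a : action) (sigma s t a)%:E * next_mean U (value U n) (last s t).1 a.
Proof. by move=> st; rewrite esum_step// => s'; exact: value_ge0. Qed.

(** The scheduler averages the means over the actions, and an average is at most the largest of
    them. *)
Lemma policy_value_le sigma n s t : history U s t ->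
  policy_value sigma n s t <= value U n (last s t).1.
Proof.
elim: n t => [//|n ih] t st /=; case lstE: (last s t).1 => [//|d w].
rewrite leeD2l// -lstE -/(best_next n (last s t)).
apply: (@le_trans _ _ (\esum_(s' in [set: state W])
    ((Defs.step sigma s t s')%:E * value U n s'.1))).
  apply: le_esum => s' _; apply: lee_wpmul2l; first by rewrite lee_fin step_ge0.
  by case: ifP => [/ih|_]; rewrite ?last_rcons// value_ge0.
rewrite esum_step_value// -[leRHS]mul1e.
have <- : (\sum_(a : action) sigma s t a)%:E = 1 by rewrite sched_sum1.
rewrite -sumEFin ge0_sume_distrl => [|a _]; last by rewrite lee_fin sched_ge0.
apply: lee_sum => a _.
by rewrite lee_wpmul2l ?next_mean_le_best// lee_fin sched_ge0.
Qed.

Definition best_action n s : action :=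
  if enabled s Tau then Tau
  else if next_mean U (value U n) s.1 El <= next_mean U (value U n) s.1 Th
  then Th else El.

Lemma best_action_enabled n s : enabled s (best_action n s).
Proof.
by rewrite /best_action; case: ifP => // /negbFE; case: ifP.
Qed.

Lemma next_mean_best_action n s :
  next_mean U (value U n) s.1 (best_action n s) = best_next n s.
Proof.
rewrite /best_action; case: ifPn => [sT|_]; last first.
  by rewrite /best_next maxC maxEle; case: ifP.
(* If [Tau] is enabled, the stack is empty or its top label is not nondeterministic, so
   [next_config] ignores the action. *)
have nE a : next_mean U (value U n) s.1 a = next_mean U (value U n) s.1 Tau.
  apply: eq_esum => mu _.
  suff -> : next_config s.1 a mu = next_config s.1 Tau mu by [].
  move: sT; rewrite /enabled/=; case: s.1 => // -[[f [l nu]] dl] w /=.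
  by rewrite /is_ndet/=; case: (instr l).
by rewrite /best_next !nE maxxx.
Qed.

(** * A scheduler optimal for a fixed horizon *)

Section OptimalScheduler.
Variable N : nat.

(** After the history [s :: t], [size t] steps have been made and the present one takes another, so
    successors are rated with the horizon [N - (size t).+1]. *)
Let osched s t a : R := (a == best_action (N - (size t).+1) (last s t))%:R.

Let osched_ge0 s t a : history U s t -> (0 <= osched s t a)%R.
Proof. by []. Qed.

Let osched_enabled s t a : history U s t ->
  ~~ enabled (last s t) a -> osched s t a = 0%R.
Proof.
move=> _; rewrite /osched; case: eqP => // ->.
by rewrite best_action_enabled.
Qed.

Let osched_sum1 s t : history U s t -> (\sum_(a : action) osched s t a = 1)%R.
Proof.
move=> _; rewrite (bigD1 (best_action (N - (size t).+1) (last s t)))//=.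
by rewrite /osched eqxx big1 ?addr0// => a /negbTE ->.
Qed.

Definition optimal_scheduler : scheduler U :=
  Scheduler osched_ge0 osched_enabled osched_sum1.

Lemma policy_value_optimal n s t : (n + size t = N)%N -> history U s t ->
  policy_value optimal_scheduler n s t = value U n (last s t).1.
Proof.
elim: n t => [//|n ih] t nt st /=; case lstE: (last s t).1 => [//|d w].
congr (_ + _); rewrite -lstE -/(best_next n (last s t)).
transitivity (\esum_(s' in [set: state W])
    ((Defs.step optimal_scheduler s t s')%:E * value U n s'.1)).
  apply: eq_esum => s' _; case: ifPn => [sts'|sts'].
    by rewrite ih ?last_rcons// size_rcons -nt addnS.
  by rewrite (step_notin_history _ sts')// !mul0e.
rewrite esum_step_value// (bigD1 (best_action n (last s t)))//= big1 => [|a].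
  by rewrite /osched -nt addSnnS addnK eqxx mul1e adde0 next_mean_best_action.
by rewrite /osched -nt addSnnS addnK => /negbTE ->; rewrite mul0e.
Qed.

End OptimalScheduler.

(** No scheduler exceeds the values at any horizon; conversely the value at horizon [n] is the
    truncated expectation under [optimal_scheduler n], a lower bound for its expected termination
    time. *)
Lemma Tbar_value (c : elem W) :
  Tbar U c = ereal_sup (range (fun n => value U n (push c [::]))).
Proof.
rewrite /Tbar; case: ifPn => [ct|cN].
  rewrite /push insubF ?ct//; apply/esym/eqP; rewrite eq_le; apply/andP; split.
    by apply: ge_ereal_sup => _ [n _ <-]; rewrite value_nil.
  by apply: ereal_sup_ubound; exists 0%N.
apply/eqP; rewrite eq_le; apply/andP; split; apply: ge_ereal_sup.
  move=> _ [sigma [P [Pind ->]]]; apply: (expectation_le Pind) => n.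
  apply: (le_trans (policy_value_le _ _ _)) => //.
  by apply: ereal_sup_ubound; exists n.
move=> _ [n _ <-].
have [P Pind] := induced_measure_exists (optimal_scheduler n) c.
apply: (@le_trans _ _ (\int[P]_w termination_time R w)).
  rewrite -(@policy_value_optimal n n (init c) [::]) ?addn0//.
  exact: (policy_value_le_expectation Pind).
by apply: ereal_sup_ubound; exists (optimal_scheduler n), P.
Qed.

End Optimality.

(** * Ranking inequalities *)

(** Fatou for unordered sums: a finite partial sum of [g] is the limit of the same partial sums of
    the [f n], all at most [M]. *)
Lemma esum_cvg_le (R : realType) (T : choiceType) (I : set T)
    (f : nat -> T -> \bar R) (g : T -> \bar R) M :
  (forall n i, 0 <= f n i)%E -> (forall i, f^~ i @ \oo --> g i) ->
  (forall n, \esum_(i in I) f n i <= M)%E -> (\esum_(i in I) g i <= M)%E.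
Proof.
move=> f0 fg fM; apply: ge_ereal_sup => _ [X [finX XI] <-].
rewrite fsbig_finite//=.
set r := finmap.enum_fset _.
have cvg_sum : (fun n : nat => \sum_(i <- r) f n i)%E @ \oo -->
    (\sum_(i <- r) g i)%E.
  by apply: cvg_nnesum => // i _; apply: nearW => n.
apply: (cvge_to_le cvg_sum); apply: nearW => n; apply: le_trans (fM n).
rewrite -fsbig_finite//.
by apply: esum_ge; exists X.
Qed.

Section Ranking.
Local Open Scope ereal_scope.
Variables (R : realType) (W : program) (U : sampling R W).

Lemma value_cvg_Tbar c : (fun n => value U n (push c [::])) @ \oo --> Tbar U c.
Proof.
by rewrite Tbar_value; apply: ereal_nondecreasing_cvgn; exact: value_homo.
Qed.

Lemma value_le_Tbar n c : value U n (push c [::]) <= Tbar U c.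
Proof. by rewrite Tbar_value; apply: ereal_sup_ubound; exists n. Qed.

Lemma Tbar_ge0 c : 0 <= Tbar U c.
Proof. exact: le_trans (value_ge0 U 0 _) (value_le_Tbar 0 c). Qed.

Lemma Tbar_le c M : (forall n, value U n (push c [::]) <= M) -> Tbar U c <= M.
Proof. by move=> vM; rewrite Tbar_value; apply: ge_ereal_sup => _ [n _ <-]. Qed.

(** The subtracted 1 is the step counted by [value] at horizon [n.+1]; this is the source of the
    ranking constant. *)
Lemma next_mean_le_Tbar c n a : ~~ terminal c ->
  next_mean U (value U n) (push c [::]) a <= Tbar U c - 1.
Proof.
move=> cN; rewrite leeBrDr// addeC; apply: le_trans (value_le_Tbar n.+1 c).
rewrite /push insubT/= leeD2l//.
exact: (@next_mean_le_best _ _ U n ([:: Sub c cN], [ffun=> 0%R])).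
Qed.

Lemma next_mean_cst w a (w' : config W) n :
  (forall mu, next_config w a mu = w') ->
  next_mean U (value U n) w a = value U n w'.
Proof.
move=> nw; rewrite /next_mean.
under eq_esum do rewrite nw muleC -(fineK (value_fin_num U n w')).
rewrite esumZl ?fine_ge0 ?value_ge0// => [|mu].
  by rewrite joint_esum1 mule1 fineK ?value_fin_num.
by rewrite lee_fin joint_ge0.
Qed.

End Ranking.

Theorem lemma2 (R : realType) (W : program) (U : sampling R W) :
  ranking_measure_function U 1 (Tbar U).
Proof.
split=> [|c|f nu|f l nu lN]; first exact: ltr01.
- exact: Tbar_ge0.
- by rewrite /Tbar /terminal /= eqxx.
have cN : ~~ terminal (mkelem l nu) by [].
have le_mean n a := next_mean_le_Tbar U n a cN.
have nextE a mu : next_config (push (mkelem l nu) [::]) a mu =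
    match instr l with
    | Assign u l' => push (mkelem l' (u nu mu)) [::]
    | Call g v l' => push (mkelem (l_in g) (v nu)) (push (mkelem l' nu) [::])
    | Branch phi l1 l2 => push (mkelem (if sat nu phi then l1 else l2) nu) [::]
    | Ndet l1 l2 => push (mkelem (if a is Th then l1 else l2) nu) [::]
    end.
  by rewrite /push insubT.
case: (instr l) nextE => [u l'|g v l'|phi l1 l2|l1 l2] nextE.
(* Assignment: the inequality holds for the values at each horizon and passes to the limit. *)
- rewrite addeC -leeBrDr//.
  apply: (@esum_cvg_le _ _ _
    (fun n mu =>
       (joint U mu)%:E * value U n (push (mkelem l' (u nu mu)) [::]))%E).
  + by move=> n mu; rewrite mule_ge0 ?lee_fin ?joint_ge0 ?value_ge0.
  + by move=> mu; apply: cvgeZl => //; exact: value_cvg_Tbar.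
  + move=> n; apply: le_trans (le_mean n Tau).
    (* The mean runs over all valuations; its part off the support is nonnegative and is dropped. *)
    rewrite [leRHS](esumID [set mu | 0 < joint U mu]); last first.
      by move=> mu _; rewrite mule_ge0 ?lee_fin ?joint_ge0 ?value_ge0.
    rewrite setTI -[leLHS]adde0 leeD ?esum_ge0//.
      by apply: le_esum => mu _; rewrite nextE.
    by move=> mu _; rewrite mule_ge0 ?lee_fin ?joint_ge0 ?value_ge0.
- rewrite -addeA addeC -leeBrDr//.
  have cvgD : (fun n => value U n (push (mkelem (l_in g) (v nu)) [::]) +
      value U n (push (mkelem l' nu) [::]))%E @ \oo -->
      (Tbar U (mkelem (l_in g) (v nu)) + Tbar U (mkelem l' nu))%E.
    apply: cvgeD; [|exact: value_cvg_Tbar|exact: value_cvg_Tbar].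
    by apply: ge0_adde_def; rewrite inE; exact: Tbar_ge0.
  apply: (cvge_to_le cvgD); apply: nearW => n.
  (* Callee and continuation get horizon [n] each, so by [value_cat] their stacked configuration is
     taken at horizon [n + n]. *)
  apply: le_trans (le_mean (n + n)%N Tau).
  rewrite (next_mean_cst _ _ (nextE Tau)).
  by apply: le_trans (value_cat _ _ _ _ _) _; rewrite -push_cat.
- rewrite -leeBrDr//.
  have le_next : (Tbar U (mkelem (if sat nu phi then l1 else l2) nu) <=
      Tbar U (mkelem l nu) - 1)%E.
    by apply: Tbar_le => n; rewrite -(next_mean_cst _ _ (nextE Tau)).
  move: le_next => /=; case: (sat nu phi) => /= le_next.
    by rewrite mul1e mul0e adde0.
  by rewrite mul1e mul0e add0e.
- rewrite -leeBrDr// ge_max; apply/andP; split.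
    by apply: Tbar_le => n; rewrite -(next_mean_cst _ _ (nextE Th)).
  by apply: Tbar_le => n; rewrite -(next_mean_cst _ _ (nextE El)).
Qed.
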